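(* Let $n\ge 2$ be an integer and let $\mathbf{p}=(p_1,\ldots,p_n)\in[0,1]^n$ be sorted in increasing order, $p_1\le\cdots\le p_n$. Then the following hold. (a) The ordered Schmidt, Siegel and Srinivasan bound is a valid upper bound on $\overline{P}(n,k,\mathbf{p})$: $$\overline{P}(n,k,\mathbf{p})\le\min\left(1,\ \min_{r_1\in[0,k-1]}\left(\frac{S_{1r_1}}{k-r_1}\right),\ \min_{r_2\in[0,k-2]}\left(\frac{S_{2r_2}}{\binom{k-r_2}{2}}\right)\right),\quad\forall k\in[2,n].$$ (b) The ordered Boros and Prékopa bound is a valid upper bound on $\overline{P}(n,k,\mathbf{p})$: $$\overline{P}(n,k,\mathbf{p})\le\min_{r\in[0,k-1]}BP(n-r,k-r,\mathbf{p}),\quad\forall k\in[2,n],$$ where $$BP(n-r,k-r,\mathbf{p})=\begin{cases}1, & k<\dfrac{(n-r-1)S_{1r}-2S_{2r}}{n-r-S_{1r}}+r,\\[2mm] \dfrac{(k+n-2r-1)S_{1r}-2S_{2r}}{(k-r)(n-r)}, & \dfrac{(n-r-1)S_{1r}-2S_{2r}}{n-r-S_{1r}}+r\le k<1+\dfrac{2S_{2r}}{S_{1r}}+r,\\[2mm] \dfrac{(i-1)(i-2S_{1r})+2S_{2r}}{(k-r-i)^2+(k-r-i)}, & k\ge 1+\dfrac{2S_{2r}}{S_{1r}}+r,\end{cases}$$ and $i=\left\lceil\dfrac{(k-r-1)S_{1r}-2S_{2r}}{k-r-S_{1r}}\right\rceil$. (c) The ordered Chebyshev bound is a valid upper bound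 on $\overline{P}(n,k,\mathbf{p})$: $$\overline{P}(n,k,\mathbf{p})\le\min_{r\in[0,k-1]}CH(n-r,k-r,\mathbf{p}),\quad\forall k\in[2,n],$$ where $$CH(n-r,k-r,\mathbf{p})=\begin{cases}1, & k<S_{1r}+r,\\[1mm] \dfrac{S_{1r}-(S_{1r}^2-2S_{2r})}{S_{1r}-(S_{1r}^2-2S_{2r})+(k-r-S_{1r})^2}, & S_{1r}+r\le k\le n.\end{cases}$$
   Context: For integers $a\le b$, $[a,b]=\{a,a+1,\ldots,b\}$, and $[n]=\{1,\ldots,n\}$; $K_m=\{(i,j):1\le i<j\le m\}$. $\lceil x\rceil$ is the smallest integer greater than or equal to $x$. Let $\Theta(\{0,1\}^n)$ be the set of all probability distributions on $\{0,1\}^n$; for $\theta$ in this set, $\tilde{\mathbf{c}}=(\tilde c_1,\ldots,\tilde c_n)$ denotes a Bernoulli random vector with law $\theta$. For $\mathbf{p}\in[0,1]^n$ let $$\Theta(\mathbf{p},p_ip_j;(i,j)\in K_n)=\{\theta\in\Theta(\{0,1\}^n): \mathbb{P}_\theta(\tilde c_i=1)=p_i\ \forall i\in[n],\ \mathbb{P}_\theta(\tilde c_i=1,\tilde c_j=1)=p_ip_j\ \forall (i,j)\in K_n\}$$ be the set of joint distributions of pairwise independent Bernoulli random variables with marginal probabilities $\mathbf{p}$, and let $$\overline{P}(n,k,\mathbf{p})=\max_{\theta\in\Theta(\mathbf{p},p_ip_j;(i,j)\in K_n)}\mathbb{P}_\theta\left(\sum_{i\in[n]}\tilde c_i\ge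 k\right).$$ With $p_1\le\cdots\le p_n$, the partial binomial moments are $S_{1r}=\sum_{i\in[n-r]}p_i$ for $r\in[0,n-1]$ and $S_{2r}=\sum_{(i,j)\in K_{n-r}}p_ip_j$ for $r\in[0,n-2]$; for $r=n-1$ the latter sum is empty, so $S_{2,n-1}=0$.
   Formalization: Where the Chebyshev quotient is 0/0 (zero variance and k-r=S_{1r}, e.g. p=(1,1), n=k=2, r=0), CH is taken to be 1; undefined 0/0 quotients in the thresholds and index i of BP are read as 0. *)

(* Defs.v *)
From HB Require Import structures.
From mathcomp Require Export all_boot all_order all_algebra.
From mathcomp Require Export all_classical all_reals all_analysis.

Set Implicit Arguments.
Unset Strict Implicit.
Unset Printing Implicit Defensive.

Import Order.TTheory GRing.Theory Num.Theory.
Import numFieldNormedType.Exports.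

Local Open Scope classical_set_scope.
Local Open Scope ring_scope.

(* The index set [n] = {1, ..., n} is rendered by 'I_n = {0, ..., n - 1}, so
   that the mathematical p_(i+1) is [p i]. *)

Definition outcome (n : nat) := {ffun 'I_n -> bool}.

Definition Pr (R : realType) (n : nat) (theta : outcome n -> R)
    (E : pred (outcome n)) : R :=
  \sum_(c | E c) theta c.

Definition distribution01 (R : realType) (n : nat) : set (outcome n -> R) :=
  [set theta | (forall c, 0 <= theta c) /\ \sum_c theta c = 1].

Definition pairwise_indep (R : realType) (n : nat) (p : 'I_n -> R) :
    set (outcome n -> R) :=
  [set theta | [/\ @distribution01 R n theta,
     forall i : 'I_n, Pr theta (fun c => c i) = p i &
     forall i j : 'I_n, (i < j)%N -> Pr theta (fun c => c i && c j) = p i * p j]].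

(* Booleans coerce to {0, 1}, so the sum counts the successes. *)
Definition at_least (n k : nat) : pred (outcome n) :=
  fun c => (k <= \sum_(i < n) c i)%N.

(* The supremum is a maximum: see [Pbar_attained]. *)
Definition Pbar (R : realType) (n k : nat) (p : 'I_n -> R) : R :=
  sup [set Pr theta (@at_least n k) | theta in pairwise_indep p].

(* The minimum of F 0, ..., F (m - 1), for m > 0. Taking F 0 as the initial
   value makes it exactly the minimum of these m values. *)
Definition minr_lt (R : realType) (m : nat) (F : nat -> R) : R :=
  \big[Num.min/F 0%N]_(r < m) F r.

Definition S1 (R : realType) (n : nat) (p : 'I_n -> R) (r : nat) : R :=
  \sum_(i < n | (i < n - r)%N) p i.

Definition S2 (R : realType) (n : nat) (p : 'I_n -> R) (r : nat) : R :=
  \sum_(i < n) \sum_(j < n | (i < j < n - r)%N) p i * p j.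

Definition SSS (R : realType) (n : nat) (p : 'I_n -> R)
    (k : nat) : R :=
  Num.min 1 (Num.min
    (minr_lt k (fun r => S1 p r / (k - r)%:R))
    (minr_lt k.-1 (fun r => S2 p r / 'C(k - r, 2)%:R))).

(* [BP p k r] is BP(n - r, k - r, p) and [CH p k r] is CH(n - r, k - r, p). *)

Definition BP_index (R : realType) (n : nat) (p : 'I_n -> R)
    (k r : nat) : int :=
  Num.ceil (((k%:R - r%:R - 1) * S1 p r - 2 * S2 p r) / (k%:R - r%:R - S1 p r)).

(* For p in [0, 1]^n and r < k <= n, the last two denominators are positive in
   their cases. The denominators N - r' - S1 and S1 of the thresholds lo and hi
   vanish only if p_1 = ... = p_(n-r) = 1, respectively = 0, and in the third
   case that of BP_index vanishes only if k - r of p_1, ..., p_(n-r) are 1 and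
   the others 0. These quotients are then 0 / 0 = 0, and BP is the probability
   (1, 0, 1 respectively) that c_1 + ... + c_(n-r) >= k - r. *)
Definition BP (R : realType) (n : nat) (p : 'I_n -> R)
    (k r : nat) : R :=
  let i : R := (BP_index p k r)%:~R in
  let K : R := k%:R in
  let N : R := n%:R in
  let r' : R := r%:R in
  let lo : R := ((N - r' - 1) * S1 p r - 2 * S2 p r) / (N - r' - S1 p r) + r' in
  let hi : R := 1 + 2 * S2 p r / S1 p r + r' in
  if K < lo then 1
  else if K < hi then
    ((K + N - 2 * r' - 1) * S1 p r - 2 * S2 p r) / ((K - r') * (N - r'))
  else
    ((i - 1) * (i - 2 * S1 p r) + 2 * S2 p r) / ((K - r' - i) ^+ 2 + (K - r' - i)).

(* The quotient is 0 / 0 exactly when the variance v vanishes and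
   k - r = S1 p r. Then c_1 + ... + c_(n-r) = k - r almost surely, and CH is 1,
   as it is for k - r = S1 p r and v > 0. The library's convention 0 / 0 = 0
   would make the bound false there (for instance p = (1, 1), k = 2). *)
Definition CH (R : realType) (n : nat) (p : 'I_n -> R)
    (k r : nat) : R :=
  let v : R := S1 p r - (S1 p r ^+ 2 - 2 * S2 p r) in
  let d : R := v + (k%:R - r%:R - S1 p r) ^+ 2 in
  if k%:R < S1 p r + r%:R then 1
  else if d == 0 then 1
  else v / d.

Lemma Pr_prod (R : realType) (n : nat) (p : 'I_n -> R) (A : {set 'I_n}) :
  Pr (fun c : outcome n => \prod_i (if c i then p i else 1 - p i))
     (fun c => [forall i in A, c i]) = \prod_(i in A) p i.
Proof.
pose F (i : 'I_n) (b : bool) : R :=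
  (if b then p i else 1 - p i) * ((i \in A) ==> b)%:R.
transitivity (\prod_i \sum_(b : bool) F i b).
  rewrite bigA_distr_bigA /Pr big_mkcond; apply: eq_bigr => c _.
  rewrite /F big_split /=.
  case: ifPn => [/forallP cA|].
    by rewrite [X in _ * X]big1 ?mulr1 // => i _; rewrite cA.
  rewrite negb_forall => /existsP[i] ciA.
  by rewrite [X in _ * X](bigD1 i) //= (negbTE ciA) mul0r mulr0.
rewrite [RHS]big_mkcond; apply: eq_bigr => i _; rewrite big_bool /F /=.
by case: (i \in A); rewrite /= ?mulr1 ?mulr0 ?addr0 // addrC subrK.
Qed.

Lemma pairwise_indep_nonempty (R : realType) (n : nat) (p : 'I_n -> R) :
  (forall i, 0 <= p i <= 1) -> pairwise_indep p !=set0.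
Proof.
move=> p01; exists (fun c => \prod_i (if c i then p i else 1 - p i)).
split => [|i|i j ij].
- split=> [c|].
    apply: prodr_ge0 => i _; have /andP[p0 p1] := p01 i.
    by case: (c i); rewrite ?subr_ge0.
  apply: etrans (etrans (Pr_prod p finset.set0) _); last by rewrite big_set0.
  by apply: eq_bigl => c; apply/esym/forallP => i; rewrite inE.
- apply: etrans (etrans (Pr_prod p [set i]%SET) _); last by rewrite big_set1.
  apply: eq_bigl => c; apply/idP/forallP => [ci j|/(_ i)].
    by apply/implyP; rewrite inE => /eqP ->.
  by rewrite inE eqxx.
- apply: etrans (etrans (Pr_prod p [set i; j]%SET) _); last first.
    rewrite big_setU1 ?inE ?big_set1 //=.
    by apply: contraTN ij => /eqP ->; rewrite ltnn.
  apply: eq_bigl => c; apply/andP/forallP => [[ci cj] l|cA].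
    by apply/implyP; rewrite !inE => /orP[] /eqP ->.
  by have := cA i; have := cA j; rewrite !inE !eqxx orbT.
Qed.

Lemma Pbar_attained (R : realType) (n k : nat) (p : 'I_n -> R) :
  (forall i, 0 <= p i <= 1) ->
  exists2 theta, pairwise_indep p theta &
    Pr theta (at_least k) = Pbar k p /\
    forall theta', pairwise_indep p theta' ->
      Pr theta' (at_least k) <= Pr theta (at_least k).
Proof.
move=> p01.
pose vec (v : 'rV[R]_#|{: outcome n}|) (c : outcome n) : R :=
  v ord0 (enum_rank c).
pose row_of (theta : outcome n -> R) : 'rV[R]_#|{: outcome n}| :=
  \row_j theta (enum_val j).
have vecK theta : vec (row_of theta) = theta.
  by apply: funext => c; rewrite /vec mxE enum_rankK.
have cPr (E : pred (outcome n)) : continuous (fun v => Pr (vec v) E).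
  apply: continuous_big => [|c _]; first exact: add_continuous.
  exact: coord_continuous.
have cl_eq E (x : R) : closed [set v | Pr (vec v) E = x].
  apply: (preimage_closed (f := fun v => Pr (vec v) E) (D := [set y | y = x])); last exact: closed_eq.
  by move=> v _; exact: cPr.
have cl_ge E : closed [set v | 0 <= Pr (vec v) E].
  apply: (preimage_closed (f := fun v => Pr (vec v) E) (D := [set y | 0 <= y])); last exact: closed_ge.
  by move=> v _; exact: cPr.
have Pr1 theta c : Pr theta (pred1 c) = theta c by rewrite /Pr big_pred1_eq.
pose A := [set v | pairwise_indep p (vec v)].
have AE : A = (\bigcap_c [set v | 0 <= Pr (vec v) (pred1 c)]) `&`
    [set v | Pr (vec v) predT = 1] `&`
    (\bigcap_i [set v | Pr (vec v) (fun c => c i) = p i]) `&`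
    (\bigcap_(ij in [set ij : 'I_n * 'I_n | (ij.1 < ij.2)%N])
       [set v | Pr (vec v) (fun c => c ij.1 && c ij.2) = p ij.1 * p ij.2]).
  apply/seteqP; split => v /=.
    case=> -[v0 v1] vi vij; split; last by case=> i j /= ij; exact: vij.
    split; last by move=> i _; exact: vi.
    by split => // c _ /=; rewrite Pr1.
  case=> -[[v0 v1] vi] vij; split; first split => // c.
  - by have := v0 c I; rewrite /= Pr1.
  - by move=> i; exact: vi.
  - by move=> i j ij; exact: (vij (i, j)).
have clA : closed A.
  rewrite AE; repeat apply: closedI => //; first by apply: closed_bigI => c _.
  - by apply: closed_bigI => i _; exact: cl_eq.
  - by apply: closed_bigI => -[i j] _; exact: cl_eq.
have cA : compact A.
  apply: (subclosed_compact clA).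
    apply: (rV_compact (A := fun=> [set` `[0 : R, 1]])) => _.
    exact: segment_compact.
  move=> v [[v0 v1] _ _] i /=; rewrite in_itv /=.
  have vE c : 0 <= vec v c <= 1.
    by rewrite v0 /= -v1 (bigD1 c) //= lerDl sumr_ge0.
  by have := vE (enum_val i); rewrite /vec enum_valK.
have A0 : A !=set0.
  have [theta Htheta] := pairwise_indep_nonempty p01.
  by exists (row_of theta); rewrite /A /= vecK.
have [v + vmax] := EVT_max_rV A0 cA
  (continuous_subspaceT (cPr (at_least k))).
rewrite inE => Av.
have tmax theta' : pairwise_indep p theta' ->
    Pr theta' (at_least k) <= Pr (vec v) (at_least k).
  move=> Ht; have := vmax (row_of theta'); rewrite vecK; apply.
  by rewrite inE /A /= vecK.
exists (vec v) => //; split=> //; apply/eqP; rewrite eq_le; apply/andP; split.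
- apply: ub_le_sup; last by exists (vec v).
  by exists (Pr (vec v) (at_least k)) => _ [theta' /tmax + <-].
- apply: ge_sup; first by exists (Pr (vec v) (at_least k)), (vec v).
  by move=> _ [theta' /tmax + <-].
Qed.

(* Main.v *)
Require Import Defs.
From mathcomp Require Import ring lra zify.

Set Implicit Arguments.
Unset Strict Implicit.
Unset Printing Implicit Defensive.

Import Order.TTheory GRing.Theory Num.Theory.
Local Open Scope ring_scope.

(** Fix a pairwise independent law and [r < k <= n], and let X be the sum of
    the first [n - r] of the variables. The other [r] contribute at most [r],
    so at least [k] successes force [X >= k - r]. Pairwise independence gives
    [E X = S1 p r] and [E (X (X - 1)) = 2 S2 p r]. Therefore, if
    [q x = al + be x + ga x (x - 1)] is nonnegative on 0, ..., n - r and at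
    least 1 on k - r, ..., n - r, then the probability of at least [k]
    successes is at most [E (q X) = al + be S1 + ga (2 S2)] ([Pr_le_quad]).

    With [K = k - r] and [N = n - r], every nontrivial bound is an instance:
    - Schmidt, Siegel and Srinivasan: [x / K] and [C(x, 2) / C(K, 2)];
    - Boros and Prekopa, second case: [x (K + N - x) / (K N)];
    - Boros and Prekopa, third case:
      [(x - i) (x - i + 1) / ((K - i) (K - i + 1))], nonnegative because [x]
      and [i] are integers; the point is that [i <= K - 1], which follows from
      [E ((X - K) (X - K + 1)) >= 0];
    - Chebyshev: [((x - s + b) / (K - s + b))^2], where [s = E X], [v] is the
      variance of X and [b = v / (K - s)], when [s < K]. *)

(** * Minima and sums *)

Lemma le_minr_lt (R : realType) (m : nat) (F : nat -> R) (x : R) :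
  (0 < m)%N -> (forall r, (r < m)%N -> x <= F r) -> x <= minr_lt m F.
Proof.
move=> m0 xF; rewrite /minr_lt; elim/big_ind: _ => [|a b xa xb|i _].
- exact: xF.
- by rewrite le_min xa xb.
- exact: xF.
Qed.

Lemma sqr_S1 (R : realType) (n r : nat) (x : 'I_n -> R) :
  S1 x r ^+ 2 = \sum_(i < n | (i < n - r)%N) x i ^+ 2 + 2 * S2 x r.
Proof.
have S2C : S2 x r =
    \sum_(i < n | (i < n - r)%N) \sum_(j < n | (j < i)%N) x i * x j.
  rewrite /S2 (exchange_big_dep (fun j : 'I_n => (j < n - r)%N)) /=; last first.
    by move=> i j _ /andP[].
  apply: eq_bigr => i iN.
  by apply: eq_big => [j|j _]; rewrite ?iN ?andbT // mulrC.
have S2E : S2 x r = \sum_(i < n | (i < n - r)%N)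
    \sum_(j < n | (i < j < n - r)%N) x i * x j.
  rewrite /S2 [RHS]big_mkcond; apply: eq_bigr => i _.
  case: ifPn => // iN; rewrite big1 // => j /andP[ij jN].
  by rewrite (ltn_trans ij jN) in iN.
rewrite mulr_natl mulr2n {1}S2E S2C -!big_split /= expr2 /S1 mulr_suml.
apply: eq_bigr => i iN; rewrite mulr_sumr (bigD1 i) //= expr2; congr (_ + _).
rewrite (bigID (fun j : 'I_n => (i < j)%N)) /=.
congr (_ + _); apply: eq_bigl => j; move: iN; rewrite -val_eqE /=; lia.
Qed.

(** * Moments of a partial sum *)

(** Expectation of [f] under [theta]. *)
Definition Ex (R : realType) (n : nat) (theta f : outcome n -> R) : R :=
  \sum_c theta c * f c.

(** The outcome [c] as a vector of real numbers, so that [S1 (ind R c) r] is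
    the number of successes among the first [n - r] variables. *)
Definition ind (R : realType) (n : nat) (c : outcome n) (i : 'I_n) : R :=
  (c i)%:R.

Section PartialSum.
Variables (R : realType) (n : nat) (p : 'I_n -> R) (theta : outcome n -> R).
Hypothesis theta_p : pairwise_indep p theta.

Lemma Ex_Pr (E : pred (outcome n)) : Ex theta (fun c => (E c)%:R) = Pr theta E.
Proof.
rewrite /Ex /Pr [RHS]big_mkcond; apply: eq_bigr => c _.
by case: (E c); rewrite ?mulr1 ?mulr0.
Qed.

Lemma Ex_le (f g : outcome n -> R) :
  (forall c, f c <= g c) -> Ex theta f <= Ex theta g.
Proof.
case: theta_p => -[theta0 _] _ _ fg; apply: ler_sum => c _.
exact: ler_wpM2l.
Qed.

Lemma Ex_S1 r : Ex theta (fun c => S1 (ind R c) r) = S1 p r.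
Proof.
case: theta_p => _ pi _; rewrite /Ex /S1.
under eq_bigr do rewrite mulr_sumr.
by rewrite exchange_big; apply: eq_bigr => i _; rewrite -pi -Ex_Pr.
Qed.

Lemma Ex_S2 r : Ex theta (fun c => S2 (ind R c) r) = S2 p r.
Proof.
case: theta_p => _ _ pij; rewrite /Ex /S2.
under eq_bigr do rewrite mulr_sumr.
rewrite exchange_big; apply: eq_bigr => i _.
under eq_bigr do rewrite mulr_sumr.
rewrite exchange_big; apply: eq_bigr => j /andP[ij _].
rewrite -pij // -Ex_Pr; apply: eq_bigr => c _.
by rewrite /ind -natrM mulnb.
Qed.

Lemma S2_ind (c : outcome n) r :
  2 * S2 (ind R c) r = S1 (ind R c) r * (S1 (ind R c) r - 1).
Proof.
have idem : \sum_(i < n | (i < n - r)%N) ind R c i ^+ 2 = S1 (ind R c) r.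
  by apply: eq_bigr => i _; rewrite /ind -natrX; case: (c i).
by rewrite mulrBr mulr1 -expr2 sqr_S1 idem addrAC subrr add0r.
Qed.

Lemma Ex_quad r (al be ga : R) :
  Ex theta (fun c => let x := S1 (ind R c) r in
                     al + be * x + ga * (x * (x - 1)))
  = al + be * S1 p r + ga * (2 * S2 p r).
Proof.
case: theta_p => -[_ theta1] _ _.
have Ex_al : al = \sum_c theta c * al by rewrite -mulr_suml theta1 mul1r.
rewrite -Ex_S1 -Ex_S2 [X in _ = X + _ + _]Ex_al /Ex !mulr_sumr -!big_split.
by apply: eq_bigr => c _ /=; rewrite -S2_ind; ring.
Qed.

Lemma S1_ind (c : outcome n) r :
  S1 (ind R c) r = (\sum_(i < n | (i < n - r)%N) c i)%:R.
Proof. by rewrite natr_sum. Qed.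

Lemma partial_sum_le (c : outcome n) r :
  (\sum_(i < n | (i < n - r)%N) c i <= n - r)%N.
Proof.
rewrite -[leqRHS]card_ord -sum1_card.
rewrite (big_ord_widen_cond n xpredT (fun=> 1%N)) ?leq_subr //=.
by apply: leq_sum => i _; case: (c i).
Qed.

Lemma at_least_partial_sum (c : outcome n) k r : (r <= n)%N ->
  at_least k c -> (k - r <= \sum_(i < n | (i < n - r)%N) c i)%N.
Proof.
move=> rn; rewrite /at_least leq_subLR => /leq_trans; apply.
rewrite (bigID (fun i : 'I_n => (i < n - r)%N)) /= addnC leq_add2r.
have first1 : (\sum_(i < n | (i < n - r)%N) 1 = n - r)%N.
  by rewrite -(big_ord_widen_cond n xpredT (fun=> 1%N)) ?leq_subr // sum1_card card_ord.
have : (\sum_(i < n) 1 = n)%N by rewrite sum1_card card_ord.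
rewrite (bigID (fun i : 'I_n => (i < n - r)%N)) /= first1 => all1.
apply: (@leq_trans (\sum_(i < n | ~~ (i < n - r)%N) 1)%N); last by rewrite -(leq_add2l (n - r)) all1 subnK.
by apply: leq_sum => i _; case: (c i).
Qed.

Lemma quad_ge0 r (al be ga : R) :
  (forall x : nat, 0 <= al + be * x%:R + ga * (x%:R * (x%:R - 1))) ->
  0 <= al + be * S1 p r + ga * (2 * S2 p r).
Proof.
move=> q0; rewrite -Ex_quad; case: theta_p => -[theta0 _] _ _.
by apply: sumr_ge0 => c _; apply: mulr_ge0 => //=; rewrite S1_ind.
Qed.

(** The bound by a majorizing quadratic, on which everything rests. *)
Lemma Pr_le_quad k r (al be ga : R) : (r <= n)%N ->
  (forall x : nat, (x <= n - r)%N ->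
     0 <= al + be * x%:R + ga * (x%:R * (x%:R - 1))) ->
  (forall x : nat, (k - r <= x <= n - r)%N ->
     1 <= al + be * x%:R + ga * (x%:R * (x%:R - 1))) ->
  Pr theta (at_least k) <= al + be * S1 p r + ga * (2 * S2 p r).
Proof.
move=> rn q0 q1; rewrite -Ex_Pr -Ex_quad; apply: Ex_le => c /=.
rewrite S1_ind; case: (boolP (at_least k c)) => [kc|_].
  by apply: q1; rewrite (at_least_partial_sum rn kc) partial_sum_le.
by apply: q0; exact: partial_sum_le.
Qed.

Lemma Pr_le1 (E : pred (outcome n)) : Pr theta E <= 1.
Proof.
case: theta_p => -[theta0 <-] _ _; rewrite /Pr big_mkcond.
by apply: ler_sum => c _; case: ifP.
Qed.

(** The variance of the partial sum is nonnegative. *)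
Lemma variance_ge0 r : 0 <= S1 p r - (S1 p r ^+ 2 - 2 * S2 p r).
Proof.
have := @quad_ge0 r (S1 p r ^+ 2) (1 - 2 * S1 p r) 1.
have -> : S1 p r ^+ 2 + (1 - 2 * S1 p r) * S1 p r + 1 * (2 * S2 p r) =
  S1 p r - (S1 p r ^+ 2 - 2 * S2 p r) by ring.
apply=> x; have -> : S1 p r ^+ 2 + (1 - 2 * S1 p r) * x%:R +
  1 * (x%:R * (x%:R - 1)) = (x%:R - S1 p r) ^+ 2 by ring.
exact: sqr_ge0.
Qed.

(** The product of two consecutive integers is nonnegative. *)
Lemma consecutive_ge0 (z : int) : 0 <= (z%:~R : R) * (z%:~R + 1).
Proof.
have -> : (z%:~R : R) * (z%:~R + 1) = (z * (z + 1))%:~R by rewrite rmorphM rmorphD.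
by rewrite ler0z; nia.
Qed.

(** Nonnegativity of [E ((X - K) (X - K + 1))]. *)
Lemma consecutive_moment_ge0 r (K : nat) :
  0 <= (K%:R - 1) * (K%:R - 2 * S1 p r) + 2 * S2 p r.
Proof.
have := @quad_ge0 r (K%:R * (K%:R - 1)) (- 2 * (K%:R - 1)) 1.
have -> : K%:R * (K%:R - 1) + - 2 * (K%:R - 1) * S1 p r + 1 * (2 * S2 p r) =
  (K%:R - 1) * (K%:R - 2 * S1 p r) + 2 * S2 p r by ring.
apply=> x; have := consecutive_ge0 (x%:Z - K%:Z).
by rewrite rmorphB /=; congr (_ <= _); rewrite -!pmulrn; ring.
Qed.

(** * The bounds for one law *)

Lemma Pr_le_SSS1 k r : (r < k <= n)%N ->
  Pr theta (at_least k) <= S1 p r / (k - r)%:R.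
Proof.
move=> /andP[rk kn]; have K0 : 0 < (k - r)%:R :> R by rewrite ltr0n subn_gt0.
have := @Pr_le_quad k r 0 (k - r)%:R^-1 0.
rewrite mul0r add0r addr0 mulrC; apply; first lia.
- by move=> x _; rewrite mul0r add0r addr0 mulr_ge0 // invr_ge0 ltW.
- move=> x /andP[Kx _]; rewrite mul0r add0r addr0 mulrC ler_pdivlMr // mul1r.
  by rewrite ler_nat.
Qed.

Lemma Pr_le_SSS2 k r : (r < k.-1)%N -> (k <= n)%N ->
  Pr theta (at_least k) <= S2 p r / 'C(k - r, 2)%:R.
Proof.
move=> rk kn.
have binE (x : nat) : x%:R * (x%:R - 1) = 2 * 'C(x, 2)%:R :> R.
  case: x => [|x]; first by rewrite bin0n mul0r mulr0.
  rewrite -[X in _ * (X - 1)]natr1 addrK -!natrM; congr _%:R.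
  by have := mul_bin_diag x.+1 1; rewrite bin1.
have C0 : 0 < 'C(k - r, 2)%:R :> R by rewrite ltr0n bin_gt0; lia.
have := @Pr_le_quad k r 0 0 (2 * 'C(k - r, 2)%:R)^-1.
have -> : 0 + 0 * S1 p r + (2 * 'C(k - r, 2)%:R)^-1 * (2 * S2 p r) =
  S2 p r / 'C(k - r, 2)%:R by field; rewrite gt_eqF.
have qE (x : nat) : 0 + 0 * x%:R + (2 * 'C(k - r, 2)%:R)^-1 *
   (x%:R * (x%:R - 1)) = 'C(x, 2)%:R / 'C(k - r, 2)%:R :> R.
  by rewrite binE; field; rewrite gt_eqF.
apply; first lia.
- by move=> x _; rewrite qE divr_ge0.
- move=> x /andP[Kx _]; rewrite qE ler_pdivlMr // mul1r ler_nat.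
  exact: leq_bin2l.
Qed.

(** The majorant [((x - s + b) / (K - s + b))^2] for [b = v / (K - s)] is the
    square of an affine function equal to 1 at K; among these, this [b] makes
    the expectation smallest. *)
Lemma Pr_le_CH k r : (r < k <= n)%N -> Pr theta (at_least k) <= CH p k r.
Proof.
move=> /andP[rk kn]; rewrite /CH; set v := S1 p r - _; set d := v + _.
case: ifPn => [_|]; first exact: Pr_le1.
rewrite -leNgt => sk; case: eqP => [_|/eqP d0]; first exact: Pr_le1.
have v0 : 0 <= v := variance_ge0 r.
(* If K = s, the bound is v / v = 1. *)
have [a0|a0] := eqVneq (k%:R - r%:R - S1 p r) 0.
  move: d0; rewrite /d a0 expr0n addr0 => v1.
  by rewrite divff //; exact: Pr_le1.
have KE : (k - r)%:R = k%:R - r%:R :> R by rewrite natrB // ltnW.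
set a := k%:R - r%:R - S1 p r in a0 d d0 *.
have {a0} a0 : 0 < a by rewrite lt_def a0 /= /a; lra.
pose b := v / a.
have b0 : 0 <= b by rewrite divr_ge0 // ltW.
have ab0 : 0 < a + b by lra.
pose g := (a + b) ^- 2.
have := @Pr_le_quad k r (g * (b - S1 p r) ^+ 2) (g * (1 + 2 * (b - S1 p r))) g.
have -> : g * (b - S1 p r) ^+ 2 + g * (1 + 2 * (b - S1 p r)) * S1 p r +
   g * (2 * S2 p r) = v / d.
  transitivity (g * (v + b ^+ 2)); first by rewrite /v; ring.
  rewrite /g /b; have ->: v + (v / a) ^+ 2 = v * d / a ^+ 2.
    by rewrite /d; field; rewrite gt_eqF.
  have -> : a + v / a = d / a by rewrite /d; field; rewrite gt_eqF.
  by field; rewrite d0 gt_eqF.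
have qE (x : nat) : g * (b - S1 p r) ^+ 2 + g * (1 + 2 * (b - S1 p r)) * x%:R +
   g * (x%:R * (x%:R - 1)) = ((x%:R - S1 p r + b) / (a + b)) ^+ 2.
  by rewrite exprMn exprVn -/g; ring.
apply; first lia.
- by move=> x _; rewrite qE sqr_ge0.
- move=> x /andP[Kx _]; rewrite qE.
  rewrite exprn_ege1 // ler_pdivlMr // mul1r lerD2r /a lerD2r -KE.
  by rewrite ler_nat.
Qed.

Lemma Pr_le_BP_mid k r : (r < k <= n)%N ->
  Pr theta (at_least k) <=
  ((k%:R + n%:R - 2 * r%:R - 1) * S1 p r - 2 * S2 p r) /
  ((k%:R - r%:R) * (n%:R - r%:R)).
Proof.
move=> /andP[rk kn].
have KE : (k - r)%:R = k%:R - r%:R :> R by rewrite natrB // ltnW.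
have NE : (n - r)%:R = n%:R - r%:R :> R by rewrite natrB //; lia.
have K0 : 0 < (k - r)%:R :> R by rewrite ltr0n; lia.
have N0 : 0 < (n - r)%:R :> R by rewrite ltr0n; lia.
have -> : k%:R + n%:R - 2 * r%:R - 1 = (k - r)%:R + (n - r)%:R - 1 :> R.
  by rewrite KE NE; ring.
rewrite -KE -NE; set K : R := (k - r)%:R in K0 *; set N : R := (n - r)%:R in N0 *.
have KN0 : 0 < K * N by rewrite mulr_gt0.
have := @Pr_le_quad k r 0 ((K + N - 1) / (K * N)) (- (K * N)^-1).
have -> : 0 + (K + N - 1) / (K * N) * S1 p r + - (K * N)^-1 * (2 * S2 p r) =
  ((K + N - 1) * S1 p r - 2 * S2 p r) / (K * N) by ring.
have qE (x : nat) : 0 + (K + N - 1) / (K * N) * x%:R +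
  - (K * N)^-1 * (x%:R * (x%:R - 1)) = (x%:R * (K + N - x%:R)) / (K * N) by ring.
apply; first lia.
- move=> x xN; rewrite qE divr_ge0 //; last exact: ltW.
  by rewrite mulr_ge0 //; have : x%:R <= N by [rewrite ler_nat]; lra.
- move=> x /andP[Kx xN]; rewrite qE ler_pdivlMr // mul1r.
  have : K <= x%:R by rewrite ler_nat.
  have : x%:R <= N by rewrite ler_nat.
  by nra.
Qed.

(** An integer index [i < K] gives a valid bound; [BP] uses
    [i = BP_index p k r]. *)
Lemma Pr_le_BP_int k r (i : int) : (r < k <= n)%N -> i < k%:Z - r%:Z ->
  Pr theta (at_least k) <=
  ((i%:~R - 1) * (i%:~R - 2 * S1 p r) + 2 * S2 p r) /
  ((k%:R - r%:R - i%:~R) ^+ 2 + (k%:R - r%:R - i%:~R)).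
Proof.
move=> /andP[rk kn] iK; set t : R := i%:~R.
have KE : (k - r)%:R = k%:R - r%:R :> R by rewrite natrB // ltnW.
rewrite -KE; set K : R := (k - r)%:R.
have tK : 0 < K - t.
  rewrite subr_gt0 /t /K -[(k - r)%:R]/((k - r)%:Z%:~R) ltr_int; lia.
pose D := (K - t) ^+ 2 + (K - t).
have D0 : 0 < D by rewrite /D; nra.
have := @Pr_le_quad k r (t * (t - 1) / D) (- 2 * (t - 1) / D) D^-1.
have -> : t * (t - 1) / D + - 2 * (t - 1) / D * S1 p r + D^-1 * (2 * S2 p r) =
  ((t - 1) * (t - 2 * S1 p r) + 2 * S2 p r) / D by ring.
have qE (x : nat) : t * (t - 1) / D + - 2 * (t - 1) / D * x%:R +
   D^-1 * (x%:R * (x%:R - 1)) = (x%:R - t) * (x%:R - t + 1) / D by ring.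
apply; first lia.
- move=> x _; rewrite qE divr_ge0 //; last exact: ltW.
  by have := consecutive_ge0 (x%:Z - i); rewrite rmorphB.
- move=> x /andP[Kx _]; rewrite qE ler_pdivlMr // mul1r.
  have : K <= x%:R by rewrite ler_nat.
  by rewrite /D; nra.
Qed.

(** In the third case of the Boros and Prekopa bound, [E X <= K] because
    [E (X (X - 1)) <= (K - 1) E X]. If equality holds, the quotient defining
    the index has denominator 0, and the index is 0. *)
Lemma BP_index_lt k r : (forall i, 0 <= p i) -> (r < k)%N ->
  1 + 2 * S2 p r / S1 p r + r%:R <= k%:R -> BP_index p k r < k%:Z - r%:Z.
Proof.
move=> p0 rk hi; rewrite /BP_index.
have KE : (k - r)%:R = k%:R - r%:R :> R by rewrite natrB // ltnW.
have K1 : 1 <= (k - r)%:R :> R by rewrite ler1n subn_gt0.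
have s0 : 0 <= S1 p r by apply: sumr_ge0 => i _.
have sK : S1 p r <= (k - r)%:R.
  move: s0; rewrite le_eqVlt => /orP[/eqP <-|s0]; first by lra.
  have : 2 * S2 p r / S1 p r <= (k - r)%:R - 1 by rewrite KE; lra.
  rewrite ler_pdivrMr // => tK; have v0 := variance_ge0 r.
  by rewrite -(ler_pM2r s0); nra.
rewrite -KE; move: sK; rewrite le_eqVlt => /orP[/eqP ->|sK].
  by rewrite subrr invr0 mulr0 ceil0; lia.
apply: (@le_lt_trans _ _ (k%:Z - r%:Z - 1)); last by lia.
rewrite ceil_le_int ler_pdivrMr ?subr_gt0 //.
have -> : (k%:Z - r%:Z - 1)%:~R = (k - r)%:R - 1 :> R.
  by rewrite KE !rmorphB.
by have := consecutive_moment_ge0 r (k - r); lra.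
Qed.

Lemma Pr_le_BP k r : (forall i, 0 <= p i) -> (r < k <= n)%N ->
  Pr theta (at_least k) <= BP p k r.
Proof.
move=> p0 rkn; rewrite /BP; case: ifP => [_|_]; first exact: Pr_le1.
case: ifPn => [_|]; first exact: Pr_le_BP_mid.
rewrite -leNgt => hi; apply: Pr_le_BP_int => //.
by apply: BP_index_lt => //; case/andP: rkn.
Qed.

End PartialSum.

(** * The bounds for the maximum *)

Theorem theorem3p1 (R : realType) (n : nat) (p : 'I_n -> R)
  (hn : (2 <= n)%N)
  (hp : forall i : 'I_n, 0 <= p i <= 1)
  (hsort : forall i j : 'I_n, (i <= j)%N -> p i <= p j) :
  (forall k : nat, (2 <= k <= n)%N -> Pbar k p <= SSS p k) /\
  (forall k : nat, (2 <= k <= n)%N -> Pbar k p <= minr_lt k (BP p k)) /\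
  (forall k : nat, (2 <= k <= n)%N -> Pbar k p <= minr_lt k (CH p k)).
Proof.
have p0 i : 0 <= p i by case/andP: (hp i).
split; [|split] => k /andP[k2 kn];
  have [theta theta_p [<- _]] := Pbar_attained k hp.
- rewrite /SSS !le_min; apply/and3P; split; first exact: Pr_le1 theta_p _.
  + apply: le_minr_lt => [|r rk]; first lia.
    by apply: Pr_le_SSS1 => //; rewrite rk kn.
  + apply: le_minr_lt => [|r rk]; first lia.
    by apply: Pr_le_SSS2.
- apply: le_minr_lt => [|r rk]; first lia.
  by apply: Pr_le_BP => //; rewrite rk kn.
- apply: le_minr_lt => [|r rk]; first lia.
  by apply: Pr_le_CH => //; rewrite rk kn.
Qed.
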